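(* Let $K_1$ and $K_2$ be fields of characteristic $2$. If the stable linear groups $\mathrm{GL}(K_1)$ and $\mathrm{GL}(K_2)$ are elementarily equivalent (as groups, i.e. they satisfy the same first-order sentences in the language of groups), then the fields $K_1$ and $K_2$ are elementarily equivalent (i.e. they satisfy the same first-order sentences in the language of rings).
   Context: Two structures of the same signature are elementarily equivalent if they satisfy the same first-order sentences in that signature. For an associative ring $R$ with unit, $\mathrm{Mat}_\infty(R)$ denotes the ring of matrices with rows and columns indexed by the positive integers such that only finitely many off-diagonal entries are nonzero and there exist $n$ and $a\in R$ such that $r_{ii}=a$ for all $i\geq n$. A matrix $A\in \mathrm{GL}_n(R)$ is identified with the element of $\mathrm{Mat}_\infty(R)$ having $A$ in the upper left $n\times n$ corner, $1$ in all remaining diagonal positions, and $0$ elsewhere. With this identification $\mathrm{GL}_n(R)\subseteq \mathrm{GL}_m(R)$ for $m\geq n$, and the stable linear group is $\mathrm{GL}(R)=\bigcup_{n\geq 1}\mathrm{GL}_n(R)$, a subgroup of the group of invertible elements of $\mathrm{Mat}_\infty(R)$. *)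

(* Defs.v *)
From HB Require Import structures.
From mathcomp Require Import all_boot all_order all_algebra.
From mathcomp Require Import boolp classical_sets functions cardinality fsbigop.

Set Implicit Arguments.
Unset Strict Implicit.
Unset Printing Implicit Defensive.

Import GRing.Theory.

Local Open Scope ring_scope.

Record signature := Signature {
  fun_symbol : Type;
  fun_arity : fun_symbol -> nat;
  rel_symbol : Type;
  rel_arity : rel_symbol -> nat
}.

Record structure (L : signature) := Structure {
  carrier :> Type;
  fun_interp : forall f : fun_symbol L,
    ('I_(fun_arity f) -> carrier) -> carrier;
  rel_interp : forall r : rel_symbol L,
    ('I_(rel_arity r) -> carrier) -> Prop
}.

(* [term L V] and [formula L V] have their free variables in the type [V]. A
   quantifier binds the variable [None] of a formula over [option V], in which
   [Some v] denotes the outer variable [v]. *)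
Inductive term (L : signature) (V : Type) : Type :=
| Var of V
| App (f : fun_symbol L) of ('I_(fun_arity f) -> term L V).

Inductive formula (L : signature) (V : Type) : Type :=
| FFalse
| FEq of term L V & term L V
| FRel (r : rel_symbol L) of ('I_(rel_arity r) -> term L V)
| FNot of formula L V
| FAnd of formula L V & formula L V
| FOr of formula L V & formula L V
| FImp of formula L V & formula L V
| FAll of formula L (option V)
| FEx of formula L (option V).

Arguments FFalse {L V}.

Fixpoint eval (L : signature) (M : structure L) (V : Type) (e : V -> M)
    (t : term L V) : M :=
  match t with
  | Var v => e v
  | App f ts => @fun_interp L M f (fun i => eval e (ts i))
  end.

Definition extend (T V : Type) (e : V -> T) (x : T) (v : option V) : T :=
  if v is Some w then e w else x.

Fixpoint sat (L : signature) (M : structure L) (V : Type) (e : V -> M)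
    (phi : formula L V) : Prop :=
  match phi with
  | FFalse => False
  | FEq s t => eval e s = eval e t
  | FRel r ts => @rel_interp L M r (fun i => eval e (ts i))
  | FNot p => ~ sat e p
  | FAnd p q => sat e p /\ sat e q
  | FOr p q => sat e p \/ sat e q
  | FImp p q => sat e p -> sat e q
  | FAll p => forall x : M, sat (extend e x) p
  | FEx p => exists x : M, sat (extend e x) p
  end.

Definition sentence (L : signature) : Type := formula L void.

Definition models (L : signature) (M : structure L) (phi : sentence L) : Prop :=
  sat (of_void M) phi.

Definition elementarily_equivalent (L : signature) (M N : structure L) : Prop :=
  forall phi : sentence L, models M phi <-> models N phi.

Variant group_symbol := GroupOne | GroupInv | GroupMul.

Definition group_arity (f : group_symbol) : nat :=
  match f with GroupOne => 0 | GroupInv => 1 | GroupMul => 2 end.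

Definition group_language : signature :=
  Signature group_arity (of_void nat).

Definition group_structure (G : groupType) : structure group_language :=
  @Structure group_language G
    (fun f => match f return ('I_(group_arity f) -> G) -> G with
     | GroupOne => fun _ => 1%g
     | GroupInv => fun a => (a ord0)^-1%g
     | GroupMul => fun a => (a ord0 * a ord_max)%g
     end)
    (fun r => match r with end).

Variant ring_symbol := RingZero | RingOne | RingOpp | RingAdd | RingMul.

Definition ring_arity (f : ring_symbol) : nat :=
  match f with
  | RingZero | RingOne => 0
  | RingOpp => 1
  | RingAdd | RingMul => 2
  end.

Definition ring_language : signature :=
  Signature ring_arity (of_void nat).

Definition ring_structure (R : pzRingType) : structure ring_language :=
  @Structure ring_language R
    (fun f => match f return ('I_(ring_arity f) -> R) -> R with
     | RingZero => fun _ => 0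
     | RingOne => fun _ => 1
     | RingOpp => fun a => - a ord0
     | RingAdd => fun a => a ord0 + a ord_max
     | RingMul => fun a => a ord0 * a ord_max
     end)
    (fun r => match r with end).

(* Rows and columns are indexed by [nat], i.e. from 0 instead of 1. *)
Section MatInfPred.
Variable R : nzRingType.

Definition matinf_prop (A : nat -> nat -> R) : Prop :=
  finite_set [set ij : nat * nat | ij.1 <> ij.2 /\ A ij.1 ij.2 <> 0] /\
  exists (n : nat) (a : R), forall i, (n <= i)%N -> A i i = a.

Definition matinf_pred : {pred (nat -> nat -> R)} :=
  fun A => `[< matinf_prop A >].

Lemma matinfP (A : nat -> nat -> R) :
  A \in matinf_pred <->
  exists (n : nat) (a : R),
    forall i j, (n <= maxn i j)%N -> A i j = a *+ (i == j).
Proof.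
split.
  move=> /asboolP[fA [n [a Aa]]].
  have [s sE] := (finite_seqP _).1 fA.
  pose N := (\max_(p <- s) (maxn p.1 p.2).+1)%N.
  exists (maxn n N), a => i j le_ij.
  have [eij|neij] := eqVneq i j.
    rewrite -eij maxnn in le_ij *.
    by rewrite Aa// (leq_trans _ le_ij)// leq_maxl.
  apply/eqP; apply: contraT => /eqP Aij.
  have : [set ij : nat * nat | ij.1 <> ij.2 /\ A ij.1 ij.2 <> 0]%classic (i, j).
    by split=> //=; apply/eqP.
  rewrite sE /= => ij_s.
  have : ((maxn i j).+1 <= N)%N.
    exact: (@leq_bigmax_seq _ s xpredT (fun p : nat * nat => (maxn p.1 p.2).+1) (i, j)).
  by move=> /leq_trans/(_ (leq_maxr n N))/leq_trans/(_ le_ij); rewrite ltnn.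
move=> [n [a Aa]]; apply/asboolP; split; last first.
  by exists n, a => i ni; rewrite Aa ?maxnn// eqxx.
apply: (@sub_finite_set _ _ [set` allpairs pair (iota 0 n) (iota 0 n)]).
  move=> [i j] /= [neij Aij].
  apply/allpairsP; exists (i, j); rewrite !mem_iota /= !add0n.
  have : (maxn i j < n)%N.
    by rewrite ltnNge; apply/negP => /Aa; case: eqP.
  by rewrite gtn_max => /andP[-> ->].
exact: finite_seq.
Qed.

End MatInfPred.

Record matinf (R : nzRingType) := MatInf {
  matinf_fun :> nat -> nat -> R;
  _ : matinf_fun \in @matinf_pred R
}.

HB.instance Definition _ (R : nzRingType) := [isSub for @matinf_fun R].
HB.instance Definition _ (R : nzRingType) := [Choice of matinf R by <:].

Section MatInfRing.
Variable R : nzRingType.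
Implicit Types A B C : matinf R.

Lemma matinf_zmod_closed : zmod_closed (@matinf_pred R).
Proof.
split; first by apply/matinfP; exists 0%N, 0 => i j _; rewrite mul0rn.
move=> A B /matinfP[n [a Aa]] /matinfP[m [b Bb]].
apply/matinfP; exists (maxn n m), (a - b) => i j; rewrite geq_max => /andP[ni mi].
by rewrite mulrnBl -Aa// -Bb.
Qed.

HB.instance Definition _ :=
  GRing.SubChoice_isSubZmodule.Build _ _ (matinf R) matinf_zmod_closed.

Lemma matinf_ext A B : (forall i j, A i j = B i j) -> A = B.
Proof. by move=> eAB; apply: val_inj; apply/funext => i; apply/funext => j; exact: eAB. Qed.

Lemma matinf_bound A : exists (n : nat) (a : R),
  forall i j, (n <= maxn i j)%N -> A i j = a *+ (i == j).
Proof. by apply/matinfP; case: A. Qed.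

Lemma matinf_row A i : exists n : nat, forall j, (n <= j)%N -> A i j = 0.
Proof.
have [n [a Aa]] := matinf_bound A; exists (maxn n i.+1) => j.
rewrite geq_max => /andP[nj ij]; rewrite Aa ?(leq_trans nj) ?leq_maxr//.
by rewrite ltn_eqF.
Qed.

(* The sum has only finitely many nonzero terms. *)
Definition matinf_mul_fun A B (i j : nat) : R :=
  \sum_(k \in [set: nat]) (A i k * B k j).

Lemma matinf_mul_funE A B n i j : (forall k, (n <= k)%N -> A i k = 0) ->
  matinf_mul_fun A B i j = \sum_(k < n) A i k * B k j.
Proof.
move=> A0; rewrite (fsbig_ord _ _ (fun k => A i k * B k j)); apply: esym.
apply: fsbig_widen => // k [_ /= nk].
by rewrite A0 ?mul0r// leqNgt; apply/negP.
Qed.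

Lemma matinf_mul_subproof A B : matinf_mul_fun A B \in @matinf_pred R.
Proof.
have [n [a Aa]] := matinf_bound A; have [m [b Bb]] := matinf_bound B.
apply/matinfP; exists (maxn n m), (a * b) => i j nmij.
have [ni nj] : (n <= maxn i j /\ m <= maxn i j)%N.
  by move: nmij; rewrite geq_max => /andP.
have rowE k : (n <= maxn i j)%N -> (maxn n (maxn i j).+1 <= k)%N -> A i k = 0.
  rewrite geq_max => _ /andP[nk ijk]; rewrite Aa ?(leq_trans nk) ?leq_maxr//.
  by rewrite ltn_eqF//; apply: leq_ltn_trans ijk; apply: leq_maxl.
rewrite (matinf_mul_funE _ _ (fun k => rowE k ni)).
set N := maxn n _.
have iN : (i < N)%N by rewrite /N !leq_max !ltnS leq_maxl orbT.
have [nlei|iltn] := leqP n i.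
  have Ai k : A i k = a *+ (i == k) by rewrite Aa// leq_max nlei.
  rewrite (bigD1 (Ordinal iN))//= big1 ?addr0 => [|k /eqP neki]; last first.
    rewrite Ai; case: eqP => [eik|_]; last by rewrite mul0r.
    by case: neki; apply: val_inj.
  rewrite Ai eqxx mulr1n; have [eij|neij] := eqVneq i j.
    by rewrite eij Bb ?eqxx // -eij; move: nj; rewrite -eij maxnn.
  by rewrite Bb// (negPf neij) mulr0.
have ltij : (i < j)%N.
  by move: ni; rewrite leq_max leqNgt iltn /=; apply: leq_trans.
have mj : (m <= j)%N by move: nj; rewrite (maxn_idPr (ltnW ltij)).
have nj' : (n <= j)%N by move: ni; rewrite (maxn_idPr (ltnW ltij)).
rewrite big1 ?ltn_eqF// => k _.
rewrite Bb ?leq_max ?mj ?orbT//; have [ekj|_] := eqVneq (k : nat) j.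
  by rewrite ekj Aa ?leq_max ?nj' ?orbT// (ltn_eqF ltij) mul0r.
by rewrite mulr0.
Qed.

Definition matinf_mul A B : matinf R := MatInf (matinf_mul_subproof A B).

Lemma matinf_one_subproof :
  (fun i j : nat => ((i == j)%:R : R)) \in @matinf_pred R.
Proof. by apply/matinfP; exists 0%N, 1. Qed.

Definition matinf_one : matinf R := MatInf matinf_one_subproof.

Lemma matinf_row3 A B C i : exists n : nat, forall j, (n <= j)%N ->
  [/\ A i j = 0, B i j = 0 & C i j = 0].
Proof.
have [n1 h1] := matinf_row A i; have [n2 h2] := matinf_row B i.
have [n3 h3] := matinf_row C i; exists (maxn n1 (maxn n2 n3)) => j.
by rewrite !geq_max => /and3P[? ? ?]; rewrite h1 ?h2 ?h3.
Qed.

Lemma matinf_mulA : associative matinf_mul.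
Proof.
move=> A B C; apply: matinf_ext => i j.
have [n nA] := matinf_row3 A (matinf_mul A B) A i.
have A0 k : (n <= k)%N -> A i k = 0 by move=> /nA[].
have AB0 k : (n <= k)%N -> matinf_mul A B i k = 0 by move=> /nA[].
rewrite /= (matinf_mul_funE _ _ A0).
rewrite (matinf_mul_funE _ _ AB0) /=.
have [m [b Bb]] := matinf_bound B.
have B0 (k : 'I_n) l : (maxn m n <= l)%N -> B k l = 0.
  rewrite geq_max => /andP[ml nl]; rewrite Bb ?leq_max ?ml ?orbT//.
  by rewrite ltn_eqF// (leq_trans _ nl).
have AB0' l : (maxn n (maxn m n) <= l)%N -> matinf_mul A B i l = 0.
  by rewrite geq_max => /andP[/AB0].
rewrite -(matinf_mul_funE _ _ AB0) (matinf_mul_funE _ _ AB0') /=.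
under [RHS]eq_bigr do rewrite (matinf_mul_funE _ _ A0) mulr_suml.
rewrite exchange_big /=; apply: eq_bigr => k _.
have B0' l : (maxn n (maxn m n) <= l)%N -> B k l = 0.
  by rewrite geq_max => /andP[_ /B0].
by rewrite (matinf_mul_funE _ _ B0') mulr_sumr; apply: eq_bigr => l _; rewrite mulrA.
Qed.

Lemma matinf_mul1r : left_id matinf_one matinf_mul.
Proof.
move=> A; apply: matinf_ext => i j /=.
have one0 k : (i.+1 <= k)%N -> matinf_one i k = 0 by move=> ik /=; rewrite ltn_eqF.
rewrite (matinf_mul_funE _ _ one0) /= big_ord_recr/= eqxx mul1r big1 ?add0r// => k _.
by rewrite gtn_eqF// mul0r.
Qed.

Lemma matinf_mulr1 : right_id matinf_one matinf_mul.
Proof.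
move=> A; apply: matinf_ext => i j /=.
have [n A0] := matinf_row A i.
have A0' k : (maxn n j.+1 <= k)%N -> A i k = 0 by rewrite geq_max => /andP[/A0].
have jn : (j < maxn n j.+1)%N by rewrite leq_maxr.
rewrite (matinf_mul_funE _ _ A0') (bigD1 (Ordinal jn))//= eqxx mulr1.
rewrite big1 ?addr0// => k /eqP nkj; case: eqP => [ekj|]; last by rewrite mulr0.
by case: nkj; apply: val_inj.
Qed.

Lemma matinf_addE A B i j : (A + B) i j = A i j + B i j.
Proof. by []. Qed.

Lemma matinf_mulE A B i j : matinf_mul A B i j = matinf_mul_fun A B i j.
Proof. by []. Qed.

Lemma matinf_mulDl : left_distributive matinf_mul +%R.
Proof.
move=> A B C; apply: matinf_ext => i j.
have [n nA] := matinf_row3 A B (A + B) i.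
rewrite matinf_addE !matinf_mulE.
have A0 k : (n <= k)%N -> A i k = 0 by move=> /nA[].
have B0 k : (n <= k)%N -> B i k = 0 by move=> /nA[].
have AB0 k : (n <= k)%N -> (A + B) i k = 0 by move=> /nA[].
rewrite (matinf_mul_funE _ _ A0) (matinf_mul_funE _ _ B0).
rewrite (matinf_mul_funE _ _ AB0) -big_split.
by apply: eq_bigr => k _; rewrite matinf_addE mulrDl.
Qed.

Lemma matinf_mulDr : right_distributive matinf_mul +%R.
Proof.
move=> A B C; apply: matinf_ext => i j.
have [n nA] := matinf_row A i.
rewrite matinf_addE !matinf_mulE.
rewrite !(matinf_mul_funE _ _ nA) -big_split.
by apply: eq_bigr => k _; rewrite matinf_addE mulrDr.
Qed.

Lemma matinf_one_neq0 : matinf_one != 0.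
Proof.
apply/eqP => /(congr1 (fun A : matinf R => A 0 0)) /eqP.
by rewrite /= oner_eq0.
Qed.

HB.instance Definition _ := GRing.Zmodule_isNzRing.Build (matinf R)
  matinf_mulA matinf_mul1r matinf_mulr1 matinf_mulDl matinf_mulDr
  matinf_one_neq0.

Definition matinf_unit_prop A : Prop := exists B, B * A = 1 /\ A * B = 1.

Definition matinf_unit : pred (matinf R) := fun A => `[< matinf_unit_prop A >].

Definition matinf_inv A : matinf R :=
  if pselect (matinf_unit_prop A) is left uA then projT1 (cid uA) else A.

Lemma matinf_mulVr : {in matinf_unit, left_inverse 1 matinf_inv *%R}.
Proof.
move=> A /asboolP uA; rewrite /matinf_inv; case: pselect => // u.
by case: cid => B [].
Qed.

Lemma matinf_divrr : {in matinf_unit, right_inverse 1 matinf_inv *%R}.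
Proof.
move=> A /asboolP uA; rewrite /matinf_inv; case: pselect => // u.
by case: cid => B [].
Qed.

Lemma matinf_unitrP A B : B * A = 1 /\ A * B = 1 -> matinf_unit A.
Proof. by move=> BA; apply/asboolP; exists B. Qed.

Lemma matinf_invr_out : {in [predC matinf_unit], matinf_inv =1 id}.
Proof. by move=> A /asboolP uA; rewrite /matinf_inv; case: pselect. Qed.

HB.instance Definition _ := GRing.NzRing_hasMulInverse.Build (matinf R)
  matinf_mulVr matinf_divrr matinf_unitrP matinf_invr_out.

End MatInfRing.

Section StableGL.
Variable R : comUnitRingType.

Definition mx_stab_fun n (M : 'M[R]_n) (i j : nat) : R :=
  match insub i, insub j with
  | Some i', Some j' => M i' j'
  | _, _ => (i == j)%:R
  end.

Lemma mx_stab_out n (M : 'M[R]_n) i j : (n <= maxn i j)%N ->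
  mx_stab_fun M i j = (i == j)%:R.
Proof.
rewrite /mx_stab_fun; case: insubP => // i' ltin _; case: insubP => // j' ltjn _.
by rewrite leqNgt gtn_max ltin ltjn.
Qed.

Lemma mx_stab_in n (M : 'M[R]_n) (i j : 'I_n) : mx_stab_fun M i j = M i j.
Proof. by rewrite /mx_stab_fun !valK. Qed.

Lemma mx_stab_subproof n (M : 'M[R]_n) : mx_stab_fun M \in @matinf_pred R.
Proof. by apply/matinfP; exists n, 1 => i j; apply: mx_stab_out. Qed.

Definition mx_stab n (M : 'M[R]_n) : matinf R := MatInf (mx_stab_subproof M).

Lemma mx_stab1 n : mx_stab (1%:M : 'M[R]_n) = 1.
Proof.
apply: matinf_ext => i j; rewrite /= /mx_stab_fun.
case: insubP => // i' _ <-; case: insubP => // j' _ <-.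
by rewrite mxE.
Qed.

Lemma mx_stabM n (M N : 'M[R]_n) : mx_stab (M *m N) = mx_stab M * mx_stab N.
Proof.
apply: matinf_ext => i j /=.
have row0 k : (maxn n i.+1 <= k)%N -> mx_stab M i k = 0.
  rewrite geq_max => /andP[nk ik].
  by rewrite /= mx_stab_out ?ltn_eqF// leq_max nk orbT.
have [ltin|leni] := ltnP i n; last first.
  have row k : mx_stab M i k = (i == k)%:R.
    by rewrite /= mx_stab_out// leq_max leni.
  rewrite mx_stab_out ?leq_max ?leni//.
  have row1 k : (i.+1 <= k)%N -> mx_stab M i k = 0.
    by move=> ik; rewrite row ltn_eqF.
  rewrite (matinf_mul_funE _ _ row1) big_ord_recr/= (mx_stab_out M) ?leq_max ?leni//.
  rewrite eqxx mul1r big1 ?add0r ?mx_stab_out ?leq_max ?leni// => k _.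
  by rewrite mx_stab_out ?leq_max ?leni// gtn_eqF ?mul0r.
have row1 k : (n <= k)%N -> mx_stab M i k = 0.
  by move=> nk; apply: row0; rewrite geq_max nk (leq_trans ltin).
rewrite (matinf_mul_funE _ _ row1) /=.
have [ltjn|lenj] := ltnP j n.
  rewrite (mx_stab_in _ (Ordinal ltin) (Ordinal ltjn)) mxE; apply: eq_bigr => k _.
  by rewrite -(mx_stab_in M) -(mx_stab_in N).
rewrite mx_stab_out ?leq_max ?lenj ?orbT// ltn_eqF ?(leq_trans ltin)//.
rewrite big1// => k _; rewrite (mx_stab_out N) ?leq_max ?lenj ?orbT//.
by rewrite ltn_eqF ?mulr0// (leq_trans (ltn_ord k)).
Qed.

Lemma mx_stab_widen n m (M : 'M[R]_n) : (n <= m)%N -> M \in unitmx ->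
  exists2 N : 'M[R]_m, N \in unitmx & mx_stab N = mx_stab M.
Proof.
move=> lenm uM.
pose st (P : 'M[R]_n) := \matrix_(i < m, j < m) mx_stab P i j.
have stE P : mx_stab (st P) = mx_stab P.
  apply: matinf_ext => i j /=; have [ltm|gem] := ltnP (maxn i j) m.
    have [lti ltj] : (i < m)%N /\ (j < m)%N by move: ltm; rewrite gtn_max => /andP.
    by rewrite (mx_stab_in _ (Ordinal lti) (Ordinal ltj)) mxE.
  by rewrite !mx_stab_out// (leq_trans lenm).
have stab_inj (P Q : 'M[R]_m) : mx_stab P = mx_stab Q -> P = Q.
  move=> ePQ; apply/matrixP => i j.
  by rewrite -(mx_stab_in P) -(mx_stab_in Q); move: ePQ => /(congr1 (fun A : matinf R => A i j)).
exists (st M); last exact: stE.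
suff /mulmx1_unit[] : st M *m st (invmx M) = 1%:M by [].
by apply: stab_inj; rewrite mx_stabM !stE -mx_stabM mulmxV// !mx_stab1.
Qed.

(* [mx_stab] identifies GL_n(R), the units of ['M[R]_n], with a subset of the
   units of [matinf R]; [stable_GL_prop] is the union of these subsets. *)
Definition stable_GL_prop (A : matinf R) : Prop :=
  exists n : nat, (1 <= n)%N /\
    exists M : 'M[R]_n, M \in unitmx /\ A = mx_stab M.

Definition stable_GL_pred : {pred matinf R} := fun A => `[< stable_GL_prop A >].

Lemma stable_GL_one : 1 \in stable_GL_pred.
Proof.
apply/asboolP; exists 1%N; split=> //; exists 1%:M.
by rewrite unitmx1 mx_stab1.
Qed.

Lemma stable_GL_mul A B :
  A \in stable_GL_pred -> B \in stable_GL_pred -> A * B \in stable_GL_pred.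
Proof.
move=> /asboolP[n [n0 [M [uM ->]]]] /asboolP[m [m0 [N [uN ->]]]].
have [M' uM' <-] := mx_stab_widen (leq_maxl n m) uM.
have [N' uN' <-] := mx_stab_widen (leq_maxr n m) uN.
apply/asboolP; exists (maxn n m); split; first by rewrite leq_max n0.
by exists (M' *m N'); rewrite unitmx_mul uM' uN' mx_stabM.
Qed.

Lemma stable_GL_unit A : A \in stable_GL_pred -> A \is a GRing.unit.
Proof.
move=> /asboolP[n [n0 [M [uM ->]]]]; apply/unitrP; exists (mx_stab (invmx M)).
by rewrite -!mx_stabM mulmxV// mulVmx// mx_stab1.
Qed.

Lemma stable_GL_inv A : A \in stable_GL_pred -> A^-1 \in stable_GL_pred.
Proof.
move=> GA; have uA := stable_GL_unit GA.
move: GA uA => /asboolP[n [n0 [M [uM ->]]]] uA.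
apply/asboolP; exists n; split=> //; exists (invmx M); rewrite unitmx_inv uM.
by split=> //; apply: (mulrI uA); rewrite mulrV// -mx_stabM mulmxV// mx_stab1.
Qed.

End StableGL.

Record stable_GL (R : comUnitRingType) := StableGL {
  stable_GL_val :> matinf R;
  _ : stable_GL_val \in @stable_GL_pred R
}.

HB.instance Definition _ (R : comUnitRingType) :=
  [isSub for @stable_GL_val R].
HB.instance Definition _ (R : comUnitRingType) :=
  [Choice of stable_GL R by <:].

Section StableGLGroup.
Variable R : comUnitRingType.
Implicit Types x y z : stable_GL R.

Definition sGL_one : stable_GL R := StableGL (@stable_GL_one R).
Definition sGL_mul x y : stable_GL R :=
  StableGL (stable_GL_mul (valP x) (valP y)).
Definition sGL_inv x : stable_GL R := StableGL (stable_GL_inv (valP x)).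

Lemma sGL_mulA : associative sGL_mul.
Proof. by move=> x y z; apply: val_inj; rewrite /= mulrA. Qed.

Lemma sGL_mul1g : left_id sGL_one sGL_mul.
Proof. by move=> x; apply: val_inj; rewrite /= mul1r. Qed.

Lemma sGL_mulg1 : right_id sGL_one sGL_mul.
Proof. by move=> x; apply: val_inj; rewrite /= mulr1. Qed.

Lemma sGL_mulV : left_inverse sGL_one sGL_inv sGL_mul.
Proof.
by move=> x; apply: val_inj; rewrite /= mulVr// (stable_GL_unit (valP x)).
Qed.

Lemma sGL_divV : right_inverse sGL_one sGL_inv sGL_mul.
Proof.
by move=> x; apply: val_inj; rewrite /= mulrV// (stable_GL_unit (valP x)).
Qed.

HB.instance Definition _ := isGroup.Build (stable_GL R)
  sGL_mulA sGL_mul1g sGL_mulg1 sGL_mulV sGL_divV.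

End StableGLGroup.

(* Main.v *)
Require Import Defs.
From mathcomp Require Import all_boot all_order all_algebra.
From mathcomp Require Import boolp ring.

(** The field K is interpreted in the group GL(K), with any nontrivial involution
    t as a parameter, by formulas which do not depend on K.

    In characteristic 2 an involution is t = 1 + N with N^2 = 0 and N of finite
    rank. Its double centralizer in GL(K) is the group of all 1 + a N with a in K
    ([double_centralizer_scale]): the centralizer of t is rich enough to force a
    matrix commuting with it to be a polynomial in N, and there is no scalar in
    GL(K) except 1. Since (1 + a N)(1 + b N) = 1 + (a + b) N, the group law on the
    double centralizer is the addition of K, the neutral element is 0 and t itself
    is 1. Multiplication comes from conjugation: if h t h^-1 = 1 + a N, then
    h N h^-1 = a N, hence h (1 + b N) h^-1 = 1 + a b N, and for a <> 0 such an h
    exists, because one can rescale by a on the image of N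
    ([scale_conj_exists]). Thus the double centralizer of t, defined by a formula
    in t, carries a definable copy of K ([involution_coordinates]).

    A ring sentence phi is translated accordingly into a group formula phi' with
    the parameter t ([sat_interpret]). Then K satisfies phi exactly when GL(K)
    satisfies: some nontrivial involution satisfies phi' ([models_interpret]).
    The truth of the latter sentence is transferred by elementary equivalence. *)

Set Implicit Arguments.
Unset Strict Implicit.
Unset Printing Implicit Defensive.

Import GRing.Theory.

Local Open Scope ring_scope.

(** * Square-zero matrices *)

Section SquareZeroMatrices.
Variables (F : fieldType) (n : nat).
Implicit Types (A B N M T H : 'M[F]_n) (a b : F).

(** The hypothesis is what remains of commutation with the matrices
    N u f + u f N. Only pairs with f N u = 0 are available, so u and f are first
    corrected by multiples of vectors u0, f0 with f0 N u0 = 1. With a = f0 M u0,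
    the difference P = M - a N then satisfies P u = 0 if f0 N u = 0, and f P = 0 if
    f N u0 = 0, hence f P u is a multiple of f0 P u0 = 0 for all f and u. *)
Lemma proportional_mx N M : N != 0 ->
    (forall (u : 'cV_n) (f : 'rV_n), f *m N *m u = 0 ->
       M *m u *m (f *m N) = N *m u *m (f *m M)) ->
  exists a, M = a *: N.
Proof.
move=> /matrix0Pn[r [s Nrs]] NM.
pose f0 : 'rV[F]_n := (N r s)^-1 *: delta_mx 0 r.
pose u0 : 'cV[F]_n := delta_mx s 0.
have entryE (f : 'rV[F]_n) A (u : 'cV[F]_n) :
    f *m A *m u = ((f *m A *m u) 0 0)%:M by rewrite -mx11_scalar.
have N1 : f0 *m N *m u0 = 1%:M.
  rewrite /f0 -!scalemxAl -rowE -colE [LHS]mx11_scalar !mxE.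
  by rewrite mulVf.
clearbody f0 u0.
set a := (f0 *m M *m u0) 0 0.
have Ma : f0 *m M *m u0 = a%:M by rewrite entryE.
exists a; pose P := M - a *: N.
have Pu0 (u : 'cV[F]_n) : f0 *m N *m u = 0 -> P *m u = 0.
  move=> fu; move/(congr1 (mulmx^~ u0)): (NM _ _ fu).
  rewrite -[LHS]mulmxA -[RHS]mulmxA N1 Ma mulmx1 mul_mx_scalar => E.
  by rewrite mulmxBl E -scalemxAl subrr.
have f0P (f : 'rV[F]_n) : f *m N *m u0 = 0 -> f *m P = 0.
  move=> fu; move/(congr1 (mulmx f0)): (NM _ _ fu).
  rewrite !mulmxA N1 Ma -!mulmxA mul_scalar_mx mul1mx => E.
  by rewrite mulmxBr -E -scalemxAr subrr.
have P00 : f0 *m P *m u0 = 0.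
  rewrite mulmxBr mulmxBl Ma -scalemxAr -scalemxAl N1.
  by rewrite scalemx1 subrr.
suff /eqP : P = 0 by rewrite subr_eq0 => /eqP.
have Pu (u : 'cV[F]_n) : f0 *m P *m u = 0.
  have : f0 *m N *m (u - (f0 *m N *m u) 0 0 *: u0) = 0.
    rewrite mulmxBr -scalemxAr N1 [f0 *m N *m u]entryE scalemx1.
    by rewrite !mxE mulr1n subrr.
  move=> /Pu0 /(congr1 (mulmx f0)) /eqP.
  by rewrite mulmxA mulmxBr -scalemxAr P00 scaler0 subr0 mulmx0 => /eqP.
have fPu (f : 'rV[F]_n) (u : 'cV[F]_n) : f *m P *m u = 0.
  have : (f - (f *m N *m u0) 0 0 *: f0) *m N *m u0 = 0.
    rewrite !mulmxBl -!scalemxAl N1 [f *m N *m u0]entryE scalemx1.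
    by rewrite !mxE mulr1n subrr.
  move=> /f0P /(congr1 (mulmx^~ u)) /eqP.
  by rewrite !mulmxBl -!scalemxAl Pu scaler0 subr0 mul0mx => /eqP.
apply/matrixP => i j; have := fPu (delta_mx 0 i) (delta_mx j 0).
by rewrite -rowE -colE => /matrixP/(_ 0 0); rewrite !mxE.
Qed.

Lemma unipotent_unitmx (X : 'M[F]_n) : X *m X *m X = 0 -> 1%:M + X \in unitmx.
Proof.
move=> X3; suff /mulmx1_unit[] : (1%:M + X) *m (1%:M - X + X *m X) = 1%:M by [].
rewrite mulmxDl mul1mx mulmxDr mulmxBr mulmx1 mulmxA X3 addr0.
by rewrite addrACA subrr addr0 subrK.
Qed.

(** For T = 1 + N with N^2 = 0 this is 1 + a N, the point with parameter a on the
    one-parameter group through T. *)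
Definition scale_unipotent a T : 'M[F]_n := 1%:M + a *: (T - 1%:M).

Lemma scale_unipotent_unit a T : (T - 1%:M) *m (T - 1%:M) = 0 ->
  scale_unipotent a T \in unitmx.
Proof.
move=> N2; apply: unipotent_unitmx.
by rewrite -!(scalemxAl, scalemxAr) N2 mul0mx !scaler0.
Qed.

Lemma scale_unipotentD a b T : (T - 1%:M) *m (T - 1%:M) = 0 ->
  scale_unipotent a T *m scale_unipotent b T = scale_unipotent (a + b) T.
Proof.
move=> N2; rewrite /scale_unipotent mulmxDl mul1mx mulmxDr mulmx1.
by rewrite -scalemxAl -scalemxAr N2 !scaler0 addr0 scalerDl addrA addrAC.
Qed.

Lemma scale_unipotent_conj a H T : H *m T = scale_unipotent a T *m H <->
  H *m (T - 1%:M) = a *: (T - 1%:M) *m H.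
Proof.
rewrite /scale_unipotent mulmxDl mul1mx mulmxBr mulmx1.
split=> [->|/eqP]; first by rewrite addrAC subrr add0r.
by rewrite subr_eq addrC => /eqP.
Qed.

(** With Q a generalized inverse of N, the matrix E = N Q is a projection onto the
    image of N. The conjugating matrix multiplies this image by a and is the
    identity on the kernel of E; since N kills its own image, only the values of N
    are rescaled. *)
Lemma scale_conj_exists a N : a != 0 -> N *m N = 0 ->
  exists2 H, H \in unitmx & H *m N = a *: N *m H.
Proof.
move=> a0 N2; pose E := N *m pinvmx N.
have EN : E *m N = N by rewrite mulmxKpV.
have NE : N *m E = 0 by rewrite mulmxA N2 mul0mx.
have EE : E *m E = E by rewrite {2}/E mulmxA EN.
clearbody E.
exists (1%:M + (a - 1) *: E); last first.
  rewrite mulmxDl mul1mx -(scalemxAl (a - 1)) EN -{1}[N]scale1r -scalerDl.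
  by rewrite -scalemxAl mulmxDr -scalemxAr NE scaler0 addr0 mulmx1 addrC subrK.
suff /mulmx1_unit[] : (1%:M + (a - 1) *: E) *m (1%:M + (a^-1 - 1) *: E) = 1%:M.
  by [].
rewrite mulmxDl mul1mx mulmxDr mulmx1 -scalemxAl -scalemxAr EE scalerA.
rewrite -addrA -!scalerDl -[RHS]addr0; congr (_ + _).
suff -> : a^-1 - 1 + (a - 1 + (a - 1) * (a^-1 - 1)) = 0 by rewrite scale0r.
by rewrite mulrBr mulr1 mulrBl mul1r divff //; ring.
Qed.

End SquareZeroMatrices.

(** * Coordinates on a double centralizer *)

Section Coordinates.
Variables (G : groupType) (t : G).
Implicit Types x y z h : G.
Local Open Scope group_scope.

Definition double_centralizer x := forall h, h * t = t * h -> h * x = x * h.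

(** If x = 1 + a N and y = 1 + b N lie on the line of t = 1 + N, any h conjugating
    t to x satisfies h N = a N h, and so conjugates y to 1 + a b N. No h exists for
    a = 0, hence the first disjunct. *)
Definition conj_product x y z :=
  x = 1 /\ z = 1 \/ exists h, h * t = x * h /\ h * y = z * h.

(** A bijection c from R onto the double centralizer of t under which the ring
    operations become definable from t alone. In the product clause z ranges over
    the whole group, so that the defining formula needs no condition on z. *)
Record coordinates (R : pzRingType) (c : R -> G) : Prop := Coordinates {
  coordinate_centralizes : forall a, double_centralizer (c a);
  coordinate_surj : forall x, double_centralizer x -> exists a, x = c a;
  coordinate_inj : injective c;
  coordinate1 : c 1%R = t;
  coordinateD : forall a b, c (a + b)%R = c a * c b;
  coordinateM : forall a b z, conj_product (c a) (c b) z <-> z = c (a * b)%R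
}.

Lemma coordinate0 (R : pzRingType) (c : R -> G) : coordinates c -> c 0%R = 1.
Proof.
by move=> cc; apply: (mulgI (c 0%R)); rewrite -(coordinateD cc) addr0 mulg1.
Qed.

Lemma coordinateN (R : pzRingType) (c : R -> G) a y : coordinates c ->
  y * c a = 1 <-> y = c (- a)%R.
Proof.
move=> cc; have cNa : c (- a)%R * c a = 1.
  by rewrite -(coordinateD cc) addNr (coordinate0 cc).
by split=> [ya|->//]; apply: (mulIg (c a)); rewrite ya cNa.
Qed.

End Coordinates.

(** * Double centralizers in the stable linear group *)

Section Stabilization.
Variable R : comUnitRingType.

Lemma stable_GL_unitmx n (A : 'M[R]_n) : A \in unitmx ->
  mx_stab A \in @stable_GL_pred R.
Proof.
move=> /(mx_stab_widen (leqnSn n))[B uB <-].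
by apply/asboolP; exists n.+1; split=> //; exists B.
Qed.

Definition unitmx_stable n (A : 'M[R]_n) (uA : A \in unitmx) : stable_GL R :=
  StableGL (stable_GL_unitmx uA).

(** Two elements of the stable group always meet in some finite level, where their
    products can be computed with matrices. *)
Lemma common_size (x y : stable_GL R) : exists (n : nat) (A B : 'M[R]_n),
  val x = mx_stab A /\ val y = mx_stab B.
Proof.
have /asboolP[n [_ [A [uA ->]]]] := valP x.
have /asboolP[m [_ [B [uB ->]]]] := valP y.
have [A' _ <-] := mx_stab_widen (leq_maxl n m) uA.
have [B' _ <-] := mx_stab_widen (leq_maxr n m) uB.
by exists (maxn n m), A', B'.
Qed.

Lemma mx_stab_inj n : injective (@mx_stab R n).
Proof.
move=> A B eAB; apply/matrixP => i j.
by rewrite -(mx_stab_in A) -(mx_stab_in B);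
  move: eAB => /(congr1 (fun C : matinf R => C i j)).
Qed.

Lemma mx_stab_block n p (A : 'M[R]_n) :
  mx_stab (block_mx A 0 0 (1%:M : 'M_p)) = mx_stab A.
Proof.
apply: matinf_ext => i j; have [geij|] := leqP (n + p) (maxn i j).
  by rewrite /= !mx_stab_out // (leq_trans (leq_addr p n)).
rewrite gtn_max => /andP[lti ltj].
rewrite /= (mx_stab_in _ (Ordinal lti) (Ordinal ltj)).
have [] := split_ordP (Ordinal lti); have [] := split_ordP (Ordinal ltj).
- move=> j' ej i' ei; rewrite ei ej block_mxEul.
  by rewrite [i](congr1 val ei) [j](congr1 val ej) /= mx_stab_in.
- move=> j' ej i' ei; rewrite ei ej block_mxEur mxE.
  rewrite [i](congr1 val ei) [j](congr1 val ej) /= mx_stab_out.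
    by rewrite ltn_eqF // ltn_addr.
  by rewrite leq_max leq_addr orbT.
- move=> j' ej i' ei; rewrite ei ej block_mxEdl mxE.
  rewrite [i](congr1 val ei) [j](congr1 val ej) /= mx_stab_out.
    by rewrite gtn_eqF // ltn_addr.
  by rewrite leq_max leq_addr.
move=> j' ej i' ei; rewrite ei ej block_mxEdr mxE.
rewrite [i](congr1 val ei) [j](congr1 val ej) /= mx_stab_out.
  by rewrite eqn_add2l.
by rewrite leq_max leq_addr.
Qed.

End Stabilization.

Section StableCoordinates.
Variable F : fieldType.

Lemma mx_stab_scale_unipotent n a (T : 'M[F]_n) i j :
  mx_stab (scale_unipotent a T) i j =
  (i == j)%:R + a * (mx_stab T i j - (i == j)%:R).
Proof.
rewrite /= /mx_stab_fun.
case: insubP => [i' _ ei|_]; last by rewrite subrr mulr0 addr0.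
case: insubP => [j' _ ej|_]; last by rewrite subrr mulr0 addr0.
by rewrite !mxE -ei -ej.
Qed.

(** 1 + a (T - 1) does not depend on the level at which T is represented; this
    allows comparing it with elements of higher level. *)
Lemma scale_unipotent_stable a n (T : 'M[F]_n) m (T' : 'M[F]_m) :
  mx_stab T = mx_stab T' ->
  mx_stab (scale_unipotent a T) = mx_stab (scale_unipotent a T').
Proof.
by move=> eT; apply: matinf_ext => i j; rewrite !mx_stab_scale_unipotent eT.
Qed.

Lemma comm_add1mx n (X N : 'M[F]_n) :
  (1%:M + X) *m (1%:M + N) = (1%:M + N) *m (1%:M + X) <-> X *m N = N *m X.
Proof.
rewrite !(mulmxDl, mulmxDr) !(mulmx1, mul1mx) [1%:M + N + _]addrACA.
by split=> [/addrI/addrI|->].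
Qed.

Lemma val_stableM (x y : stable_GL F) : val (x * y)%g = val x * val y.
Proof. by []. Qed.

Lemma mulmx_stable n (A B C D : 'M[F]_n) (x y z w : stable_GL F) :
    val x = mx_stab A -> val y = mx_stab B ->
    val z = mx_stab C -> val w = mx_stab D ->
  (x * y = z * w)%g <-> A *m B = C *m D.
Proof.
move=> vx vy vz vw; split=> [/(congr1 val)|eABCD]; last apply: val_inj.
  by rewrite !val_stableM vx vy vz vw -!mx_stabM => /mx_stab_inj.
by rewrite !val_stableM vx vy vz vw -!mx_stabM eABCD.
Qed.

Lemma double_centralizer_mx (t x : stable_GL F) n (T A H : 'M[F]_n) :
    double_centralizer t x -> val t = mx_stab T -> val x = mx_stab A ->
  H \in unitmx -> H *m T = T *m H -> H *m A = A *m H.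
Proof.
move=> tx vt vx uH HT; pose h := unitmx_stable uH.
apply/(mulmx_stable (x := h) (y := x) (z := x) (w := h)) => //.
by apply/tx/(mulmx_stable (n := n)); eauto.
Qed.

(** At level n + n, the unitriangular block matrices with N = T - 1 as their
    off-diagonal block commute with T because N^2 = 0. Commutation of A with them
    reads A N = N and N A = N. This use of additional room is essential: within a
    fixed level the scalar matrices would also be in the double centralizer. *)
Lemma double_centralizer_annihilates (t x : stable_GL F) n (T A : 'M[F]_n) :
    double_centralizer t x -> val t = mx_stab T -> val x = mx_stab A ->
    (T - 1%:M) *m (T - 1%:M) = 0 ->
  (A - 1%:M) *m (T - 1%:M) = 0 /\ (T - 1%:M) *m (A - 1%:M) = 0.
Proof.
move=> tx vt vx; set N := T - 1%:M => N2.
have TN : T *m N = N by apply/eqP; rewrite -subr_eq0 -{2}[N]mul1mx -mulmxBl N2.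
have NT : N *m T = N by apply/eqP; rewrite -subr_eq0 -{2}[N]mulmx1 -mulmxBr N2.
have simp01 := (mulmx1, mul1mx, mulmx0, mul0mx, addr0, add0r).
pose A2 := block_mx A 0 0 (1%:M : 'M_n).
pose T2 := block_mx T 0 0 (1%:M : 'M_n).
have tx2 (H : 'M_(n + n)) :
    H \in unitmx -> H *m T2 = T2 *m H -> H *m A2 = A2 *m H.
  by apply: (double_centralizer_mx tx); rewrite mx_stab_block.
split.
  have uH : block_mx 1%:M N 0 (1%:M : 'M_n) \in unitmx.
    by rewrite unitmxE det_ublock !det1 mulr1 unitr1.
  move: (tx2 _ uH); rewrite !mulmx_block !simp01 TN.
  move=> /(_ erefl) /eq_block_mx[_ NAN _ _].
  by rewrite mulmxBl mul1mx -NAN subrr.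
have uH : block_mx 1%:M 0 N (1%:M : 'M_n) \in unitmx.
  by rewrite unitmxE det_lblock !det1 mulr1 unitr1.
move: (tx2 _ uH); rewrite !mulmx_block !simp01 NT.
move=> /(_ erefl) /eq_block_mx[_ _ NAN _].
by rewrite mulmxBr mulmx1 NAN subrr.
Qed.

(** For f N u = 0 the matrix X = N u f + u f N commutes with N and satisfies
    X^3 = 0, so 1 + X is an element of the centralizer of T. As M = A - 1 annihilates
    N on both sides, M X = X M is the identity M u f N = N u f M required by
    [proportional_mx]. The units used here exist over every field, F_2 included. *)
Lemma double_centralizer_scale (t x : stable_GL F) n (T A : 'M[F]_n) :
    double_centralizer t x -> val t = mx_stab T -> val x = mx_stab A ->
    (T - 1%:M) *m (T - 1%:M) = 0 -> T - 1%:M != 0 ->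
  exists a, A = scale_unipotent a T.
Proof.
move=> tx vt vx N2 N0.
have [MN NM] := double_centralizer_annihilates tx vt vx N2.
suff [a Ma] : exists a, A - 1%:M = a *: (T - 1%:M).
  by exists a; rewrite /scale_unipotent -Ma addrC subrK.
set N := T - 1%:M in N2 N0 MN NM *; set M := A - 1%:M in MN NM *.
have TE : T = 1%:M + N by rewrite addrC subrK.
have AE : A = 1%:M + M by rewrite addrC subrK.
clearbody N M.
apply: proportional_mx => // u f fNu.
pose X := N *m u *m f + u *m f *m N.
have N2r p (B : 'M_(p, n)) : B *m N *m N = 0 by rewrite -mulmxA N2 mulmx0.
have MNr p (B : 'M_(p, n)) : B *m N *m M = 0 by rewrite -mulmxA NM mulmx0.
have fNur p (B : 'M_(p, 1)) : B *m f *m N *m u = 0.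
  by rewrite -2!mulmxA [f *m _]mulmxA fNu mulmx0.
have X3 : X *m X *m X = 0.
  rewrite /X !(mulmxDl, mulmxDr) !mulmxA.
  by rewrite !(N2r, fNur, mul0mx, addr0, add0r).
have XN : X *m N = N *m X.
  by rewrite mulmxDl mulmxDr !mulmxA N2 N2r !mul0mx addr0 add0r.
have XT : (1%:M + X) *m T = T *m (1%:M + X).
  by rewrite TE; apply/comm_add1mx.
have := double_centralizer_mx tx vt vx (unipotent_unitmx X3) XT.
rewrite AE => /comm_add1mx; rewrite mulmxDl mulmxDr !mulmxA.
by rewrite MN MNr !mul0mx addr0 add0r.
Qed.

End StableCoordinates.

Section InvolutionCoordinates.
Variable F : fieldType.
Hypothesis char2 : 2%N \in [pchar F].

Lemma involution_nilpotent n (T : 'M[F]_n) : T *m T = 1%:M ->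
  (T - 1%:M) *m (T - 1%:M) = 0.
Proof.
move=> T2; rewrite mulmxBl mulmxBr T2 mul1mx mulmx1 opprB addrACA.
by rewrite -opprD -!mulr2n -!scaler_nat (pcharf0 char2) !scale0r subrr.
Qed.

(** The coordinate a stands for 1 + a N. Every nontrivial involution will do, of
    whatever rank, so that no first-order characterization of transvections among
    the involutions is called for. *)
Lemma involution_coordinates (t : stable_GL F) :
    t != 1%g -> (t * t)%g = 1%g ->
  exists c : F -> stable_GL F, coordinates t c.
Proof.
move=> t1 tt.
have nilp n (T : 'M_n) : val t = mx_stab T ->
    (T - 1%:M) *m (T - 1%:M) = 0 /\ T - 1%:M != 0.
  move=> vt; split.
    apply/involution_nilpotent/mx_stab_inj.
    by rewrite mx_stabM mx_stab1 -vt -val_stableM tt.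
  apply: contra_neq t1 => /eqP; rewrite subr_eq0 => /eqP T1.
  by apply: val_inj; rewrite vt T1 mx_stab1.
have [n0 [T0 [_ [vt0 _]]]] := common_size t t.
have c_unit a := scale_unipotent_unit a (nilp _ _ vt0).1.
pose c a := unitmx_stable (c_unit a).
have cE a n (T : 'M_n) : val t = mx_stab T ->
    val (c a) = mx_stab (scale_unipotent a T).
  by move=> vt; apply: scale_unipotent_stable; rewrite -vt0.
have c_val a b n (T : 'M_n) : val t = mx_stab T ->
    scale_unipotent a T = scale_unipotent b T -> a = b.
  move=> vt /addrI/eqP; rewrite -subr_eq0 -scalerBl scaler_eq0 subr_eq0.
  by rewrite (negPf (nilp _ _ vt).2) orbF => /eqP.
have c0 : c 0 = 1%g.
  apply: val_inj.
  by rewrite (cE _ _ _ vt0) /scale_unipotent scale0r addr0 mx_stab1.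
have c_inj : injective c.
  move=> a b /(congr1 val); rewrite !(cE _ _ _ vt0).
  by move=> /mx_stab_inj/(c_val _ _ _ _ vt0).
exists c; split=> //.
- move=> a h; have [n [H [T [vh vt]]]] := common_size h t.
  move/(mulmx_stable vh vt vt vh) => HT.
  apply/(mulmx_stable vh (cE a _ _ vt) (cE a _ _ vt) vh).
  rewrite /scale_unipotent mulmxDr mulmxDl mulmx1 mul1mx -scalemxAr -scalemxAl.
  by rewrite mulmxBr mulmxBl HT mulmx1 mul1mx.
- move=> x tx; have [n [T [A [vt vx]]]] := common_size t x.
  have [N2 N0] := nilp _ _ vt.
  have [a Aa] := double_centralizer_scale tx vt vx N2 N0.
  by exists a; apply: val_inj; rewrite vx Aa (cE a _ _ vt).
- apply: val_inj; rewrite (cE _ _ _ vt0) vt0 /scale_unipotent scale1r.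
  by rewrite addrC subrK.
- move=> a b; apply: val_inj.
  rewrite val_stableM !(cE _ _ _ vt0) -mx_stabM scale_unipotentD //.
  exact: (nilp _ _ vt0).1.
(* The heart of [conj_product]: conjugation by h rescales the whole line of t. *)
have conjE a b h : (h * t = c a * h)%g -> (h * c b = c (a * b)%R * h)%g.
  have [n [H [T [vh vt]]]] := common_size h t.
  move/(mulmx_stable vh vt (cE a _ _ vt) vh)/scale_unipotent_conj => HN.
  apply/(mulmx_stable vh (cE b _ _ vt) (cE (a * b) _ _ vt) vh).
  rewrite /scale_unipotent mulmxDr mulmxDl mulmx1 mul1mx -scalemxAr HN.
  by rewrite -!scalemxAl scalerA mulrC.
move=> a b z; split=> [[[ca ->]|[h [ht hb]]]|->].
- have -> : a = 0 by apply: c_inj; rewrite ca c0.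
  by rewrite mul0r c0.
- by apply: (mulIg h); rewrite -hb; apply: conjE.
have [-> | a0] := eqVneq a 0; first by left; rewrite mul0r c0.
right; have [H uH HN] := scale_conj_exists a0 (nilp _ _ vt0).1.
pose h := unitmx_stable uH; have vh : val h = mx_stab H by [].
have ht := (mulmx_stable vh vt0 (cE a _ _ vt0) vh).2
             ((scale_unipotent_conj _ _ _).2 HN).
exists h; split; first exact: ht.
exact: conjE.
Qed.

Lemma exists_involution : exists2 t : stable_GL F, t != 1%g & (t * t)%g = 1%g.
Proof.
pose T : 'M[F]_(1 + 1) := block_mx 1%:M 1%:M 0 1%:M.
have T2 : T *m T = 1%:M.
  rewrite mulmx_block !(mulmx1, mul1mx, mulmx0, mul0mx, addr0, add0r).
  by rewrite -mulr2n -scaler_nat (pcharf0 char2) scale0r -scalar_mx_block.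
have uT : T \in unitmx by have [] := mulmx1_unit T2.
exists (unitmx_stable uT).
  have val1 : val (1%g : stable_GL F) = mx_stab (1%:M : 'M_(1 + 1)).
    by rewrite mx_stab1.
  apply/eqP => /(congr1 val); rewrite val1 => /mx_stab_inj; rewrite scalar_mx_block.
  by move=> /eq_block_mx[_ /eqP]; rewrite oner_eq0.
by apply: val_inj; rewrite val_stableM -mx_stabM T2 mx_stab1.
Qed.

End InvolutionCoordinates.

(** * Interpretation of the ring language in the group language *)

Notation gterm := (term group_language).
Notation gformula := (formula group_language).

Definition one_term (W : Type) : gterm W :=
  @App group_language W GroupOne (fun i => match notF (ltn_ord i) with end).

Definition mul_term (W : Type) (s1 s2 : gterm W) : gterm W :=
  @App group_language W GroupMul (fun i => if nat_of_ord i is 0 then s1 else s2).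

Definition centralizer_formula (W : Type) (p x : W) : gformula W :=
  FAll (FImp (FEq (mul_term (Var _ None) (Var _ (Some p)))
                  (mul_term (Var _ (Some p)) (Var _ None)))
             (FEq (mul_term (Var _ None) (Var _ (Some x)))
                  (mul_term (Var _ (Some x)) (Var _ None)))).

Definition product_formula (W : Type) (p x y z : W) : gformula W :=
  FOr (FAnd (FEq (Var _ x) (one_term W)) (FEq (Var _ z) (one_term W)))
      (FEx (FAnd (FEq (mul_term (Var _ None) (Var _ (Some p)))
                      (mul_term (Var _ (Some x)) (Var _ None)))
                 (FEq (mul_term (Var _ None) (Var _ (Some y)))
                      (mul_term (Var _ (Some z)) (Var _ None))))).

(** Multiplication is not given by a group term, so ring terms have to be replaced
    by their graphs: for rho, p and y, the formula that y is the value of the term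
    when its variables are read through rho and p denotes the involution.
    Quantifying over all variable types W makes room for the intermediate values
    without an operation of substitution on formulas. *)
Definition graph (V : Type) : Type :=
  forall W : Type, (V -> W) -> W -> W -> gformula W.

Definition symbol_graph (V : Type) (f : ring_symbol) :
    ('I_(ring_arity f) -> graph V) -> graph V :=
  match f return ('I_(ring_arity f) -> graph V) -> graph V with
  | RingZero => fun _ W rho p y => FEq (Var _ y) (one_term W)
  | RingOne => fun _ W rho p y => FEq (Var _ y) (Var _ p)
  | RingOpp => fun args W rho p y =>
      FEx (FAnd (args ord0 _ (Some \o rho) (Some p) None)
                (FEq (mul_term (Var _ (Some y)) (Var _ None)) (one_term _)))
  | RingAdd => fun args W rho p y =>
      FEx (FEx (FAnd
        (FAnd (args ord0 _ (Some \o (Some \o rho)) (Some (Some p)) (Some None))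
              (args ord_max _ (Some \o (Some \o rho)) (Some (Some p)) None))
        (FEq (Var _ (Some (Some y)))
             (mul_term (Var _ (Some None)) (Var _ None)))))
  | RingMul => fun args W rho p y =>
      FEx (FEx (FAnd
        (FAnd (args ord0 _ (Some \o (Some \o rho)) (Some (Some p)) (Some None))
              (args ord_max _ (Some \o (Some \o rho)) (Some (Some p)) None))
        (product_formula (Some (Some p)) (Some None) None (Some (Some y)))))
  end.

Fixpoint term_graph (V : Type) (s : term ring_language V) : graph V :=
  match s with
  | Var v => fun W rho p y => FEq (Var _ y) (Var _ (rho v))
  | App f ss => @symbol_graph V f (fun i => term_graph (ss i))
  end.

(** Ring quantifiers become quantifiers over the double centralizer of p. *)
Fixpoint interpret (V : Type) (phi : formula ring_language V) :
    forall W : Type, (V -> W) -> W -> gformula W :=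
  match phi with
  | FFalse => fun W rho p => FFalse
  | FEq s1 s2 => fun W rho p =>
      FEx (FAnd (term_graph s1 (Some \o rho) (Some p) None)
                (term_graph s2 (Some \o rho) (Some p) None))
  | FRel r _ => match r with end
  | FNot q => fun W rho p => FNot (interpret q rho p)
  | FAnd q1 q2 => fun W rho p => FAnd (interpret q1 rho p) (interpret q2 rho p)
  | FOr q1 q2 => fun W rho p => FOr (interpret q1 rho p) (interpret q2 rho p)
  | FImp q1 q2 => fun W rho p => FImp (interpret q1 rho p) (interpret q2 rho p)
  | FAll q => fun W rho p =>
      FAll (FImp (centralizer_formula (Some p) None)
                 (interpret q (omap rho) (Some p)))
  | FEx q => fun W rho p =>
      FEx (FAnd (centralizer_formula (Some p) None)
                (interpret q (omap rho) (Some p)))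
  end.

Section Interpretation.
Variables (G : groupType) (R : pzRingType) (t : G) (c : R -> G).
Hypothesis tc : coordinates t c.

Lemma sat_centralizer W (e : W -> group_structure G) p x : e p = t ->
  sat e (centralizer_formula p x) <-> double_centralizer t (e x).
Proof. by move=> <-. Qed.

Lemma sat_product W (e : W -> group_structure G) p x y z : e p = t ->
  sat e (product_formula p x y z) <-> conj_product t (e x) (e y) (e z).
Proof. by move=> <-. Qed.

Lemma sat_term_graph V (s : term ring_language V) (eR : V -> ring_structure R)
    W (rho : V -> W) (p y : W) (e : W -> group_structure G) :
  e p = t -> (forall v, e (rho v) = c (eR v)) ->
  sat e (term_graph s rho p y) <-> e y = c (eval eR s).
Proof.
elim: s W rho p y e => [v|f ss IH] W rho p y e ep erho; first by rewrite /= erho.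
case: f ss IH => /= ss IH.
- by rewrite (coordinate0 tc).
- by rewrite ep (coordinate1 tc).
- have IHx x := IH ord0 _ (Some \o rho) (Some p) None (extend e x) ep erho.
  split=> [[x [/IHx /= -> /(coordinateN _ _ tc)]] //|ey].
  exists (c (eval eR (ss ord0))); split; first exact/IHx.
  exact/(coordinateN _ _ tc).
- have IHxy i x y' w := IH i _ (Some \o (Some \o rho)) (Some (Some p)) w
    (extend (extend e x) y') ep erho.
  split=> [[x [y' [[/IHxy/= -> /IHxy/= ->]]]]|ey].
    by rewrite -(coordinateD tc).
  exists (c (eval eR (ss ord0))), (c (eval eR (ss ord_max))).
  by rewrite -(coordinateD tc); do !split=> //; exact/IHxy.
have IHxy i x y' w := IH i _ (Some \o (Some \o rho)) (Some (Some p)) w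
  (extend (extend e x) y') ep erho.
have mxy x y' := @sat_product _ (extend (extend e x) y') (Some (Some p))
  (Some None) None (Some (Some y)) ep.
split=> [[x [y' [[/IHxy/= xE /IHxy/= yE] /mxy]]]|ey].
  by rewrite /= xE yE => /(coordinateM tc).
exists (c (eval eR (ss ord0))), (c (eval eR (ss ord_max))).
by split; [split; exact/IHxy | exact/mxy/(coordinateM tc)].
Qed.

Theorem sat_interpret V (phi : formula ring_language V)
    (eR : V -> ring_structure R) W (rho : V -> W) (p : W)
    (e : W -> group_structure G) :
  e p = t -> (forall v, e (rho v) = c (eR v)) ->
  sat e (interpret phi rho p) <-> sat eR phi.
Proof.
elim: phi eR W rho p e => {V} [V|V s1 s2|V []|V q IH|V q1 IH1 q2 IH2
  |V q1 IH1 q2 IH2|V q1 IH1 q2 IH2|V q IH|V q IH] eR W rho p e ep erho //=.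
- have graphE y s := @sat_term_graph _ s eR _ (Some \o rho) (Some p) None
    (extend e y) ep erho.
  split=> [[y [/graphE/= y1 /graphE/= y2]]|eq12].
    by apply: (coordinate_inj tc); rewrite -y1.
  by exists (c (eval eR s1)); split; apply/graphE => //=; rewrite eq12.
- by split=> Nq /(IH _ _ _ _ _ ep erho)/Nq.
- by split=> -[/(IH1 _ _ _ _ _ ep erho) h1 /(IH2 _ _ _ _ _ ep erho) h2].
- split=> -[/(IH1 _ _ _ _ _ ep erho) h1|/(IH2 _ _ _ _ _ ep erho) h2];
    by [left|right].
- by split=> h12 /(IH1 _ _ _ _ _ ep erho)/h12/(IH2 _ _ _ _ _ ep erho).
- have bindE a : sat (extend e (c a)) (interpret q (omap rho) (Some p)) <->
      sat (extend eR a) q.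
    by apply: IH => // -[v|] //=.
  have cP x := @sat_centralizer _ (extend e x) (Some p) None ep.
  split=> [allq a|allq x /cP/(coordinate_surj tc)[a /= ->]]; last exact/bindE.
  by apply/bindE/allq/cP/(coordinate_centralizes tc).
have bindE a : sat (extend e (c a)) (interpret q (omap rho) (Some p)) <->
    sat (extend eR a) q.
  by apply: IH => // -[v|] //=.
have cP x := @sat_centralizer _ (extend e x) (Some p) None ep.
split=> [[x [/cP/(coordinate_surj tc)[a /= ->] /bindE qa]]|[a /bindE qa]].
  by exists a.
by exists (c a); split=> //; apply/cP/(coordinate_centralizes tc).
Qed.

End Interpretation.

(** By [sat_interpret] all nontrivial involutions agree on the truth of the
    interpreted sentence, so asking for one of them is as good as asking for all. *)
Definition interpret_sentence (phi : sentence ring_language) :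
    sentence group_language :=
  FEx (FAnd (FAnd (FNot (FEq (Var _ None) (one_term _)))
                  (FEq (mul_term (Var _ None) (Var _ None)) (one_term _)))
            (interpret phi (of_void _) None)).

Lemma models_interpret (F : fieldType) (char2 : 2%N \in [pchar F])
    (phi : sentence ring_language) :
  models (group_structure (stable_GL F)) (interpret_sentence phi) <->
  models (ring_structure F) phi.
Proof.
have envE (t : stable_GL F) (c : F -> stable_GL F) : coordinates t c ->
    sat (extend (of_void (group_structure (stable_GL F))) t)
        (interpret phi (of_void (option void)) None) <->
    models (ring_structure F) phi.
  by move=> tc; apply: (sat_interpret tc) => // -[].
split=> [[t [[/eqP t1 tt] phit]]|Fphi].
  have [c tc] := involution_coordinates char2 t1 tt.
  exact/(envE t c tc).
have [t t1 tt] := exists_involution char2.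
have [c tc] := involution_coordinates char2 t1 tt.
exists t; split; last exact/(envE t c tc).
by split; first exact/eqP.
Qed.

Theorem theorem1 (K1 K2 : fieldType)
    (charK1 : 2%N \in [pchar K1]%R) (charK2 : 2%N \in [pchar K2]%R) :
  elementarily_equivalent (group_structure (stable_GL K1))
                          (group_structure (stable_GL K2)) ->
  elementarily_equivalent (ring_structure K1) (ring_structure K2).
Proof.
move=> GL12 phi.
apply: iff_trans (iff_sym (models_interpret charK1 phi)) _.
exact: iff_trans (GL12 _) (models_interpret charK2 phi).
Qed.
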